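(* Fix a positive integer $z$. For every positive integer $k$ there is a randomized algorithm in the ordinal query model that, on every finite metric space $(X,d)$ with $|X|=n$ and every consistent profile, makes $O(k^4\log^5 n)$ distance queries and outputs a set $C\subseteq X$ of at most $k$ centers with $\mathbb{E}[\phi_C(X)]\le O(1)\cdot \mathrm{OPT}_{k,z}(X,d)$.
   Context: Ordinal query model: $(X,d)$ is a finite metric space with $|X|=n$. Every point $x\in X$ reports a ranking $\pi_x$ of all points of $X$ such that $y$ is ranked above $y'$ only if $d(x,y)\le d(x,y')$ (ties broken arbitrarily); the collection is a profile consistent with $d$. An algorithm receives $X$, $k$ and the profile for free. Its only other access to $d$ is by querying the exact value $d(x,y)$ for pairs of its choice; each such value costs one query. For $C\subseteq X$, $d(x,C)=\min_{c\in C}d(x,c)$. The $(k,z)$-clustering cost is $\phi_C(X)=\left(\sum_{x\in X}d(x,C)^z\right)^{1/z}$, and $\mathrm{OPT}_{k,z}(X,d)=\min_{C\subseteq X,|C|=k}\phi_C(X)$. *)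

(* Defs.v *)
From HB Require Import structures.
From mathcomp Require Import all_boot all_order all_algebra perm.
From mathcomp Require Import all_classical all_reals all_analysis.
Set Implicit Arguments. Unset Strict Implicit. Unset Printing Implicit Defensive.
Import Order.TTheory GRing.Theory Num.Theory.
Local Open Scope ring_scope.

(* The point set X with |X| = n is identified with 'I_n. *)

Definition is_metric (R : realType) (n : nat) (d : 'I_n -> 'I_n -> R) : Prop :=
  [/\ forall x, d x x = 0,
      forall x y, d x y = 0 -> x = y,
      forall x y, d x y = d y x
    & forall x y w, d x w <= d x y + d y w].

(* A profile: for each point x a ranking of all points, given as the
   bijection y |-> (position of y in x's ranking), 0 = top. *)
Definition profile (n : nat) := 'I_n -> {perm 'I_n}.

Definition consistent (R : realType) (n : nat) (d : 'I_n -> 'I_n -> R)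
  (pi : profile n) : Prop :=
  forall x y y' : 'I_n, (pi x y < pi x y')%N -> d x y <= d x y'.

(* d(x, C) = min_{c in C} d(x,c)  (only meaningful for C nonempty; the
   default value of the fold is d(x,c0) for some c0 in C). *)
Definition distC (R : realType) (n : nat) (d : 'I_n -> 'I_n -> R)
  (C : {set 'I_n}) (x : 'I_n) : R :=
  \big[Num.min/ oapp (d x) 0 [pick c in C]]_(c in C) d x c.

Definition phi (R : realType) (z : nat) (n : nat) (d : 'I_n -> 'I_n -> R)
  (C : {set 'I_n}) : R :=
  powR (\sum_(x : 'I_n) distC d C x ^+ z) (z%:R^-1).

(* OPT_{k,z}(X,d) = min over C with |C| = k of phi_C(X); the default value
   of the fold is phi of the k-set {0,...,k-1} (a term of the min when k <= n). *)
Definition OPT (R : realType) (z k n : nat) (d : 'I_n -> 'I_n -> R) : R :=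
  \big[Num.min/ phi z d [set i : 'I_n | (i < k)%N]]_(C : {set 'I_n} | #|C| == k)
     phi z d C.

(* Randomized adaptive query algorithms in the ordinal query model, as
   decision trees: a leaf outputs a set of centers; a Query node asks the
   exact distance d(x,y) and continues depending on the answer; a Sample
   node draws i uniformly at random from 'I_(m+1) and continues with f i. *)
Inductive qtree (R : realType) (n : nat) : Type :=
| Leaf : {set 'I_n} -> qtree R n
| Query : 'I_n -> 'I_n -> (R -> qtree R n) -> qtree R n
| Sample : forall m : nat, ('I_m.+1 -> qtree R n) -> qtree R n.

Fixpoint num_queries (R : realType) (n : nat) (d : 'I_n -> 'I_n -> R)
  (t : qtree R n) : nat :=
  match t with
  | Leaf _ => 0%N
  | Query x y f => (num_queries d (f (d x y))).+1
  | Sample m f => \max_(i < m.+1) num_queries d (f i)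
  end.

Fixpoint all_outputs (R : realType) (n : nat) (d : 'I_n -> 'I_n -> R)
  (P : {set 'I_n} -> Prop) (t : qtree R n) : Prop :=
  match t with
  | Leaf C => P C
  | Query x y f => all_outputs d P (f (d x y))
  | Sample m f => forall i, all_outputs d P (f i)
  end.

Fixpoint expect (R : realType) (n : nat) (d : 'I_n -> 'I_n -> R)
  (g : {set 'I_n} -> R) (t : qtree R n) : R :=
  match t with
  | Leaf C => g C
  | Query x y f => expect d g (f (d x y))
  | Sample m f => (\sum_(i < m.+1) expect d g (f i)) / (m.+1)%:R
  end.

(* An algorithm receives X (i.e. n) and the profile for free; k is fixed. *)
Definition algorithm (R : realType) := forall n : nat, profile n -> qtree R n.

(* Main.v *)
Require Import Defs.
From HB Require Import structures.
From mathcomp Require Import all_boot all_order all_algebra perm.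
From mathcomp Require Import all_classical all_reals all_analysis.
From mathcomp Require Import ring lra zify.
Import Order.TTheory GRing.Theory Num.Theory.
Local Open Scope ring_scope.

Set Implicit Arguments.
Unset Strict Implicit.
Unset Printing Implicit Defensive.

(** The algorithm is deterministic and makes O(k^4 log^2 n) queries.

    The ranking of y reveals its nearest center in a set S, and the ranking of a
    center c orders its Voronoi cell by distance. Querying in each cell the
    points of rank 1, 2, 4, ... from the far end gives an estimate of
    d(y, S)^z that is an upper bound for every y and overestimates the total by
    at most a factor 2.

    A round adds to S a set hitting every ball (prefix of a ranking) that carries
    a fraction 1/O(k) of the estimated cost. There are only n^2 balls, so the
    greedy hitting set has O(k log n) points. Call an optimal cluster covered
    once S meets its kernel, the points within about the average radius of its
    center; S then serves it up to a constant factor. As long as S costs much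
    more than the optimum, some uncovered cluster carries a 1/O(k) fraction of
    the cost, and so does the smallest ball around its center that contains the
    half of the cluster lying in the kernel. That ball is itself inside the
    kernel, so each round covers a new cluster, and after k rounds S has
    O(k^2 log n) points and cost O(OPT). Finally all distances inside S are
    queried, and a best set of at most k centers of S for the points moved to
    their nearest center in S is returned. *)

(** * Elementary inequalities *)

Section Inequalities.
Variable R : realType.

Lemma exprD_le2X (z : nat) (a b : R) :
  0 <= a -> 0 <= b -> (a + b) ^+ z <= 2 ^+ z * (a ^+ z + b ^+ z).
Proof.
move=> a0 b0.
have za := exprn_ge0 z a0; have zb := exprn_ge0 z b0.
case: (leP a b) => hab.
  apply: (@le_trans _ _ ((2 * b) ^+ z)).
    by apply: lerXn2r; rewrite ?nnegrE; lra.
  by rewrite exprMn ler_pM2l ?exprn_gt0 //; lra.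
apply: (@le_trans _ _ ((2 * a) ^+ z)).
  by apply: lerXn2r; rewrite ?nnegrE; lra.
by rewrite exprMn ler_pM2l ?exprn_gt0 //; lra.
Qed.

(** Each index below [s] is the half of exactly two indices below [s.*2]; the left side is the first
    half of that longer sum. *)
Lemma sum_half_le (f : nat -> R) (s : nat) : (forall i, 0 <= f i) ->
  \sum_(i < s) f i./2 <= 2 * \sum_(i < s) f i.
Proof.
move=> f0.
have -> : 2 * (\sum_(i < s) f i) = \sum_(i < s.*2) f i./2.
  elim: s => [|s IHs]; first by rewrite !big_ord0 mulr0.
  rewrite doubleS !big_ord_recr /= -IHs uphalf_double doubleK; lra.
rewrite -addnn big_split_ord /= lerDl.
exact: sumr_ge0.
Qed.

Lemma exists_sum_ge (I : finType) (P : pred I) (f : I -> R) (k : nat) (v : R) :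
  #|P| = k -> 0 < v -> v <= \sum_(i | P i) f i ->
  exists2 i, P i & v <= k%:R * f i.
Proof.
move=> cP v0 hv.
have [/existsP[i /andP[Pi hi]]|/existsPn no] :=
  boolP [exists i, P i && (v <= k%:R * f i)]; first by exists i.
have k0 : (0 < k)%N.
  rewrite lt0n; apply/negP => /eqP k0.
  have P0 : P =i pred0 by apply: card0_eq; rewrite cP.
  by move: hv; rewrite big_pred0 ?leNgt ?v0// => i; have := P0 i.
suff : k%:R * \sum_(i | P i) f i < k%:R * v.
  by rewrite ltr_pM2l ?ltr0n// ltNge hv.
rewrite mulr_sumr.
have -> : k%:R * v = \sum_(i | P i) v by rewrite sumr_const cP mulr_natl.
apply: ltr_sum => [|i Pi].
  have : (0 < #|P|)%N by rewrite cP.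
  move=> /card_gt0P[i Pi]; apply/hasP; exists i; [exact: mem_index_enum|exact: Pi].
by have := no i; rewrite Pi/= -ltNge.
Qed.

End Inequalities.

Lemma expn_succ_ge (a t : nat) : (a ^ t.+1 + t.+1 * a ^ t <= a.+1 ^ t.+1)%N.
Proof.
elim: t => [|t IHt]; first by rewrite expn0 !expn1; lia.
rewrite [(a.+1 ^ _)%N]expnS; apply: leq_trans (leq_mul (leqnn _) IHt).
rewrite !expnS; nia.
Qed.

(** This is [(1 - 1/M)^M <= 1/2] cleared of denominators; two terms of the binomial expansion
    suffice. *)
Lemma double_expn_pred_le (M : nat) : (0 < M)%N -> (2 * M.-1 ^ M <= M ^ M)%N.
Proof.
case: M => [|a] //= _; apply: leq_trans (expn_succ_ge a a).
by rewrite !expnS; nia.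
Qed.

(** * Greedy hitting sets *)

Section HittingSet.
Variables (R : realType) (T J : finType) (F : J -> {set T}) (w : T -> R).
Variables (M : nat) (P : {set J}).
Hypothesis w_ge0 : forall x, 0 <= w x.
Hypothesis w_gt0 : 0 < \sum_x w x.
Hypothesis heavy : forall j, j \in P -> \sum_x w x <= M%:R * \sum_(x in F j) w x.

Definition missed (H : {set T}) : {set J} := [set j in P | [disjoint H & F j]].

Lemma missed_sub (H : {set T}) : missed H \subset P.
Proof. by apply/fintype.subsetP => j; rewrite /missed inE => /andP[]. Qed.

(* Averaging over the weight: some point lies in a 1/M fraction of the missed sets. *)
Lemma exists_frequent_point (U : {set J}) : U \subset P ->
  exists x, (#|U| <= M * #|[set j in U | x \in F j]|)%N.
Proof.
move=> UP.
have [/existsP//|/existsPn no] :=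
  boolP [exists x, (#|U| <= M * #|[set j in U | x \in F j]|)%N].
exfalso.
have : #|U|%:R * \sum_x w x <=
    \sum_x (M * #|[set j in U | x \in F j]|)%:R * w x.
  apply: (@le_trans _ _ (\sum_(j in U) M%:R * \sum_(x in F j) w x)).
    rewrite mulr_natl -sumr_const; apply: ler_sum => j jU.
    exact/heavy/(fintype.subsetP UP).
  rewrite -mulr_sumr (exchange_big_dep xpredT) //= mulr_sumr.
  apply: ler_sum => x _; rewrite natrM -mulrA ler_wpM2l //.
  by rewrite sumr_const mulr_natl cardsE.
apply/negP; rewrite -ltNge mulr_sumr.
have [x wx] : exists x, 0 < w x.
  have [/existsP[x wx]|/existsPn no'] := boolP [exists x, 0 < w x].
    by exists x.
  by move: w_gt0; rewrite ltNge sumr_le0// => x _; have := no' x; rewrite -leNgt.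
rewrite (bigD1 x)//= [ltRHS](bigD1 x)//=; apply: ltr_leD.
  by rewrite ltr_pM2r// ltr_nat ltnNge no.
by apply: ler_sum => y _; rewrite ler_wpM2r// ler_nat ltnW// ltnNge no.
Qed.

(** Each frequent point added leaves at most a fraction [1 - 1/M] of the missed sets. *)
Lemma missed_decay (t : nat) : exists H : {set T},
  (#|H| <= t)%N /\ (#|missed H| * M ^ t <= #|P| * M.-1 ^ t)%N.
Proof.
elim: t => [|t [H [cH mH]]].
  exists finset.set0; rewrite cards0; split => //.
  by rewrite !expn0 !muln1 subset_leq_card// missed_sub.
have [x hx] := exists_frequent_point (missed_sub H).
exists (x |: H); split; first by rewrite cardsU1; case: (x \in H) => /=; lia.
set V := finset (fun j => _) in hx.
have VU : V \subset missed H.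
  by apply/fintype.subsetP => j; rewrite /V inE => /andP[].
have -> : missed (x |: H) = missed H :\: V.
  apply/setP => j; rewrite /missed !inE -[[disjoint x |: H & F j]]setI_eq0 finset.setIUl.
  rewrite finset.setU_eq0 !setI_eq0 disjoints1.
  by case: (j \in P); case: [disjoint H & F j]; case: (x \in F j).
have cV := cardsID V (missed H).
rewrite (finset.setIidPr VU) in cV.
set u' := #|missed H :\: V| in cV *.
have h1 : (M * u' <= M.-1 * #|missed H|)%N.
  by case: (M) hx => [|M'] /= hx; [rewrite !mul0n|nia].
rewrite !expnS mulnA (mulnC u') -mulnA.
apply: (@leq_trans (M.-1 * (#|missed H| * M ^ t))).
  by rewrite !mulnA leq_mul2r h1 orbT.
by rewrite [leqRHS]mulnCA leq_mul2l mH orbT.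
Qed.

(** After [M * L] greedy steps at most [#|P| / 2 ^ L], hence no set, is missed. [1 < M] keeps [M.-1]
    positive, so its power can be cancelled. *)
Lemma hitting_set (L : nat) : (1 < M)%N -> (#|P| < 2 ^ L)%N ->
  exists H : {set T}, (#|H| <= M * L)%N /\
    forall j, j \in P -> ~~ [disjoint H & F j].
Proof.
move=> M1 cP; have [H [cH mH]] := missed_decay (M * L).
exists H; split => // j jP; apply/negP => dj.
have : (0 < #|missed H|)%N by apply/card_gt0P; exists j; rewrite /missed inE jP.
have : (2 ^ L * M.-1 ^ (M * L) <= M ^ (M * L))%N.
  by case: L {cP cH mH} => [|L]; rewrite ?muln0// !expnM -expnMn leq_exp2r ?double_expn_pred_le// ltnW.
have : (0 < M.-1 ^ (M * L))%N by rewrite expn_gt0; lia.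
nia.
Qed.

End HittingSet.

(** * Batches of queries *)

Section Ask.
Variables (R : realType) (n : nat).
Implicit Types (d e : 'I_n -> 'I_n -> R) (l : seq ('I_n * 'I_n)).

(** The answers are passed on as a total function that is 0 off the list, so what follows depends on
    the metric only through the queried pairs. *)
Fixpoint ask l (f : ('I_n -> 'I_n -> R) -> qtree R n) : qtree R n :=
  if l is p :: l' then
    Query p.1 p.2 (fun r => ask l' (fun e =>
      f (fun a b => if (a, b) == p then r else e a b)))
  else f (fun _ _ => 0).

Definition known d l : 'I_n -> 'I_n -> R :=
  fun a b => if (a, b) \in l then d a b else 0.

Lemma known_cons d p l :
  (fun a b => if (a, b) == p then d p.1 p.2 else known d l a b)
  = known d (p :: l).
Proof.
apply/funext => a; apply/funext => b; rewrite /known inE.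
by case: eqP => [<-|].
Qed.

Lemma num_queries_ask d l f :
  num_queries d (ask l f) = (size l + num_queries d (f (known d l)))%N.
Proof. by elim: l f => //= p l IHl f; rewrite IHl known_cons. Qed.

Lemma all_outputs_ask d P l f :
  all_outputs d P (ask l f) = all_outputs d P (f (known d l)).
Proof. by elim: l f => //= p l IHl f; rewrite IHl known_cons. Qed.

Lemma expect_ask d g l f :
  expect d g (ask l f) = expect d g (f (known d l)).
Proof. by elim: l f => //= p l IHl f; rewrite IHl known_cons. Qed.

End Ask.

(** * The algorithm *)

Section Algorithm.
Variables (R : realType) (z k n : nat) (pi : profile n).
Implicit Types (S H T : {set 'I_n}) (e d : 'I_n -> 'I_n -> R).

(** Read off the ranking of [y], without queries; the default [y] is reached only for empty [S]. *)
Definition nearest_center S (y : 'I_n) : 'I_n :=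
  [arg min_(c < odflt y [pick c in S] in S) (pi y c : nat)]%N.

Definition voronoi_cell S (c : 'I_n) : {set 'I_n} := [set y | nearest_center S y == c].

Definition farthest_first S (c : 'I_n) : seq 'I_n :=
  sort (fun a b => pi c b <= pi c a)%N (enum (voronoi_cell S c)).

Definition bits : nat := (trunc_log 2 n).+1.

(* The index of the point of rank [2 ^ j], ranks being counted from 1; when the
   cell is too small the query is the harmless [(c, c)]. *)
Definition probes S : seq ('I_n * 'I_n) :=
  [seq (c, nth c (farthest_first S c) (2 ^ j).-1) | c <- enum S, j <- iota 0 bits].

(** The rank of [y] from the far end of its cell is rounded down to a power of two, so the probe
    used is at least as far from the center as [y]. *)
Definition estimate S e (y : 'I_n) : R :=
  let c := nearest_center S y in let s := farthest_first S c in
  e c (nth c s (2 ^ trunc_log 2 (index y s).+1).-1) ^+ z.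

Definition rank_ball (p : 'I_n * 'I_n) : {set 'I_n} :=
  [set y | pi p.1 y <= pi p.1 p.2]%N.

(** This is [k * 4 * 2 ^ (2 * z + 1)]: a factor 2 for the overestimate, 2 for keeping half of the
    cost in [next_covers], and the constant of [cost_on_le]. *)
Definition thinness : nat := (k * 2 ^ (2 * z + 3))%N.

Definition heavy_ball S e (p : 'I_n * 'I_n) : bool :=
  (0 < \sum_y estimate S e y) &&
  (\sum_y estimate S e y <= thinness%:R * \sum_(y in rank_ball p) estimate S e y).

Definition hits_heavy S e H : bool :=
  (#|H| <= thinness * (2 * bits))%N &&
  [forall p, heavy_ball S e p ==> ~~ [disjoint H & rank_ball p]].

(** Any set passing the test will do, so no greedy procedure is run; [next_hits_heavy] shows that
    one exists. *)
Definition enlarge S e : {set 'I_n} :=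
  S :|: odflt finset.set0 [pick H | hits_heavy S e H].

Fixpoint rounds (t : nat) S (f : {set 'I_n} -> qtree R n) : qtree R n :=
  if t is t'.+1 then ask (probes S) (fun e => rounds t' (enlarge S e) f)
  else f S.

Definition proxy_cost S e T : R := \sum_y distC e T (nearest_center S y) ^+ z.

Definition admissible S T : bool :=
  [&& T \subset S, T != finset.set0 & (#|T| <= k)%N].

Definition best_subset S e : {set 'I_n} :=
  odflt finset.set0 [pick T | admissible S T &&
    [forall T', admissible S T' ==> (proxy_cost S e T <= proxy_cost S e T')]].

Definition finish S : qtree R n :=
  ask [seq (a, b) | a <- enum S, b <- enum S] (fun e => Leaf R (best_subset S e)).

Definition kclustering : qtree R n :=
  if (n <= k)%N then Leaf R (finset.setTfor 'I_n)
  else rounds k [set x : 'I_n | x == 0 :> nat]%N finish.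

(** * Execution of the rounds and query count *)

Definition next_centers d S : {set 'I_n} := enlarge S (known d (probes S)).

Lemma expect_rounds d g t S f :
  expect d g (rounds t S f) = expect d g (f (iter t (next_centers d) S)).
Proof. by elim: t S => //= t IHt S; rewrite expect_ask IHt -iterSr. Qed.

Lemma all_outputs_rounds d P t S f :
  all_outputs d P (rounds t S f) = all_outputs d P (f (iter t (next_centers d) S)).
Proof. by elim: t S => //= t IHt S; rewrite all_outputs_ask IHt -iterSr. Qed.

Lemma card_next d S :
  (#|next_centers d S| <= #|S| + thinness * (2 * bits))%N.
Proof.
apply: leq_trans (leq_card_setU _ _) _; rewrite leq_add2l.
by case: pickP => [H /andP[]|_] //=; rewrite cards0.
Qed.

Lemma card_iter_next d t S :
  (#|iter t (next_centers d) S| <= #|S| + t * (thinness * (2 * bits)))%N.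
Proof.
elim: t => [|t IHt] /=; first by rewrite addn0.
by rewrite mulSn addnCA addnC (leq_trans (card_next _ _))// leq_add2r.
Qed.

Lemma size_probes S : size (probes S) = (#|S| * bits)%N.
Proof. by rewrite size_allpairs size_iota -cardE. Qed.

(** [m] bounds the number of centers throughout, so each round asks at most [m * bits] queries. *)
Lemma num_queries_rounds d t S f (m : nat) :
  (#|S| + t * (thinness * (2 * bits)) <= m)%N ->
  (num_queries d (rounds t S f)
     <= t * (m * bits) + num_queries d (f (iter t (next_centers d) S)))%N.
Proof.
elim: t S => //= t IHt S; rewrite mulSn => hm.
rewrite num_queries_ask size_probes -iterS iterSr mulSn.
have hS : (#|S| <= m)%N by apply: leq_trans hm; exact: leq_addr.
rewrite -addnA leq_add ?leq_mul2r ?hS ?orbT//; apply: IHt.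
by apply: leq_trans hm; rewrite addnA leq_add2r card_next.
Qed.

Lemma num_queries_finish d S : num_queries d (finish S) = (#|S| * #|S|)%N.
Proof. by rewrite num_queries_ask /= addn0 size_allpairs -cardE. Qed.

Lemma num_queries_kclustering d : (0 < k)%N ->
  (num_queries d kclustering <= 2 ^ (4 * z + 12) * k ^ 4 * bits ^ 5)%N.
Proof.
move=> k0; rewrite /kclustering; case: ifP => //= _.
set S0 := finset _.
have c0 : (#|S0| <= 1)%N.
  apply/card_le1P => x; rewrite inE => /eqP x0 y; rewrite !inE.
  by apply/eqP/eqP => [y0|->//]; apply/val_inj; rewrite /= x0 y0.
pose A := (2 ^ (2 * z + 3))%N.
(* At most one initial center, and [k] additions of at most [2 * k * A * bits] points. *)
pose m := (3 * A * k ^ 2 * bits)%N.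
have A0 : (0 < A)%N by rewrite expn_gt0.
have hm : (#|S0| + k * (thinness * (2 * bits)) <= m)%N.
  rewrite /m /thinness -/A.
  have : (0 < A * k ^ 2 * bits)%N by rewrite !muln_gt0 A0 k0.
  nia.
apply: leq_trans (num_queries_rounds d _ hm) _.
rewrite num_queries_finish.
have hc := leq_trans (card_iter_next d k S0) hm.
apply: (@leq_trans (k * (m * bits) + m * m)); first by rewrite leq_add2l leq_mul.
have -> : (2 ^ (4 * z + 12) = 64 * (A * A))%N.
  by rewrite -expnD -(expnD 2 6); congr expn; lia.
(* Both terms are bounded by multiples of [k ^ 4 * bits ^ 2]; the fifth power only matches the
   stated bound. *)
have b0 : (bits ^ 2 <= bits ^ 5)%N by apply: leq_pexp2l.
have k34 : (k ^ 3 <= k ^ 4)%N by apply: leq_pexp2l.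
have AA : (A <= A * A)%N by rewrite leq_pmull.
apply: (@leq_trans (12 * (A * A) * k ^ 4 * bits ^ 2)); last first.
  by apply: leq_mul => //; rewrite !leq_mul2r; lia.
apply: (@leq_trans (3 * A * k ^ 3 * bits ^ 2 + 9 * (A * A) * k ^ 4 * bits ^ 2)).
  by rewrite /m; lia.
have : (3 * A * k ^ 3 * bits ^ 2 <= 3 * (A * A) * k ^ 4 * bits ^ 2)%N.
  by rewrite leq_mul2r; apply/orP; right; apply: leq_mul => //; lia.
lia.
Qed.

End Algorithm.

(** * Distances, nearest centers and costs *)

Section Analysis.
Variables (R : realType) (z k n : nat) (d : 'I_n -> 'I_n -> R) (pi : profile n).
Hypotheses (d_metric : is_metric d) (d_pi : consistent d pi).
Implicit Types (S T C O : {set 'I_n}) (x y c o : 'I_n).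

Local Notation nearest := (nearest_center pi).
Local Notation cell := (voronoi_cell pi).

Lemma dist_xx x : d x x = 0. Proof. by case: d_metric. Qed.
Lemma dist_eq0 x y : d x y = 0 -> x = y. Proof. by case: d_metric => _ + _ _; apply. Qed.
Lemma dist_sym x y : d x y = d y x. Proof. by case: d_metric. Qed.
Lemma dist_triangle y x w : d x w <= d x y + d y w. Proof. by case: d_metric. Qed.

Lemma dist_ge0 x y : 0 <= d x y.
Proof.
by have := dist_triangle y x x; rewrite dist_xx (dist_sym y x); lra.
Qed.

Lemma distX_ge0 x y : 0 <= d x y ^+ z. Proof. exact/exprn_ge0/dist_ge0. Qed.

Lemma distX_triangle y x w : d x w ^+ z <= 2 ^+ z * (d x y ^+ z + d y w ^+ z).
Proof.
apply: le_trans (exprD_le2X _ (dist_ge0 _ _) (dist_ge0 _ _)).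
by apply: lerXn2r; rewrite ?nnegrE ?addr_ge0 ?dist_ge0 ?dist_triangle.
Qed.

Lemma rank_le_dist x y y' : (pi x y <= pi x y')%N -> d x y <= d x y'.
Proof.
rewrite leq_eqVlt => /orP[/eqP|/d_pi//].
by move=> /val_inj/perm_inj ->.
Qed.

Lemma nearest_in S y : S != finset.set0 -> nearest S y \in S.
Proof.
case/set0Pn => c cS; rewrite /nearest_center.
by case: pickP => [c' c'S|/(_ c)]; rewrite ?cS//=; case: arg_minnP.
Qed.

Lemma nearest_le S y c : c \in S -> d y (nearest S y) <= d y c.
Proof.
move=> cS; apply: rank_le_dist; rewrite /nearest_center.
by case: pickP => [c' c'S|/(_ c)]; rewrite ?cS//=; case: arg_minnP => // i _; apply.
Qed.

Lemma distC_nearest S y : S != finset.set0 -> distC d S y = d y (nearest S y).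
Proof.
move=> S0; apply/le_anti/andP; split.
  exact/bigmin_le_cond/nearest_in.
apply: (big_ind (fun v => d y (nearest S y) <= v)).
- case: pickP => [c cS|no] /=; first exact: nearest_le.
  by case/set0Pn: S0 => c; rewrite no.
- by move=> a b ha hb; rewrite le_min ha.
- by move=> c; exact: nearest_le.
Qed.

(** The root in [phi] is left out of the analysis; [powR_root_le] restores it at the end. *)
Definition cost S : R := \sum_y d y (nearest S y) ^+ z.
Definition cost_on S O : R := \sum_(y in O) d y (nearest S y) ^+ z.

Lemma phi_cost S : S != finset.set0 -> phi z d S = powR (cost S) z%:R^-1.
Proof.
by move=> S0; congr powR; apply: eq_bigr => y _; rewrite distC_nearest.
Qed.

Lemma cost_ge0 S : 0 <= cost S.
Proof. by apply: sumr_ge0 => y _; exact: distX_ge0. Qed.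

Lemma nearestX_le S y c : c \in S -> d y (nearest S y) ^+ z <= d y c ^+ z.
Proof.
by move=> cS; apply: lerXn2r; rewrite ?nnegrE ?dist_ge0// nearest_le.
Qed.

Lemma cost_mono S T : S != finset.set0 -> S \subset T -> cost T <= cost S.
Proof.
move=> S0 /fintype.subsetP ST; apply: ler_sum => y _.
exact/nearestX_le/ST/nearest_in.
Qed.

Lemma sum_cell C (F : 'I_n -> R) : C != finset.set0 ->
  \sum_y F y = \sum_(c in C) \sum_(y in cell C c) F y.
Proof.
move=> C0; rewrite (partition_big (nearest C) (mem C)) => [|y _]; last exact: nearest_in.
by apply: eq_bigr => c _; apply: eq_bigl => y; rewrite inE.
Qed.

Lemma farthest_first_mono S c i j : (i <= j)%N ->
  (j < size (farthest_first pi S c))%N ->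
  d c (nth c (farthest_first pi S c) j) <= d c (nth c (farthest_first pi S c) i).
Proof.
move=> ij js; apply: rank_le_dist.
have tr : transitive (fun a b => pi c b <= pi c a)%N.
  by move=> y x w h1 h2; exact: leq_trans h2 h1.
have rf : reflexive (fun a b => pi c b <= pi c a)%N by move=> x.
have so : sorted (fun a b => pi c b <= pi c a)%N (farthest_first pi S c).
  by apply: sort_sorted => a b; exact: leq_total.
by apply: (sorted_leq_nth tr rf c so) => //; rewrite inE// (leq_ltn_trans ij).
Qed.

Lemma farthest_first_size S c : (size (farthest_first pi S c) <= n)%N.
Proof. by rewrite size_sort -cardE (leq_trans (max_card _))// card_ord. Qed.

(** * Accuracy of the estimated costs *)

Section Estimate.
Variable S : {set 'I_n}.
Hypothesis S_neq0 : S != finset.set0.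
Let est := estimate z pi S (known d (probes pi S)).

(** The pair looked up was really queried: ranks in a cell are at most [n], so the exponent is below
    [bits]. *)
Lemma estimateE y :
  let c := nearest S y in let s := farthest_first pi S c in
  est y = d c (nth c s (2 ^ trunc_log 2 (index y s).+1).-1) ^+ z.
Proof.
rewrite /est /estimate /known /=; set s := farthest_first _ _ _.
rewrite ifT//; apply/allpairsP; exists (nearest S y, trunc_log 2 (index y s).+1).
split => //; first by rewrite mem_enum nearest_in.
rewrite mem_iota add0n ltnS; apply: leq_trunc_log.
have : y \in s by rewrite mem_sort mem_enum inE.
by rewrite -index_mem => /leq_trans; apply; exact: farthest_first_size.
Qed.

Lemma estimate_ge0 y : 0 <= est y.
Proof. by rewrite estimateE distX_ge0. Qed.

Lemma estimate_ge y : d y (nearest S y) ^+ z <= est y.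
Proof.
rewrite estimateE dist_sym; set c := nearest S y; set s := farthest_first _ _ _.
have ys : y \in s by rewrite mem_sort mem_enum inE.
rewrite -{1}(nth_index c ys); apply: lerXn2r; rewrite ?nnegrE ?dist_ge0//.
apply: farthest_first_mono; last by rewrite index_mem.
have := @trunc_logP 2 (index y s).+1 isT isT; lia.
Qed.

(* The probe used for index [i] has index at least [i / 2], and each probe
   value is thus charged to an exact one, twice at most. *)
Lemma sum_estimate_le : \sum_y est y <= 2 * cost S.
Proof.
rewrite /cost (sum_cell est S_neq0) (sum_cell _ S_neq0) mulr_sumr.
apply: ler_sum => c cS; set s := farthest_first pi S c.
have sumE (F : 'I_n -> R) :
    \sum_(y in cell S c) F y = \sum_(i < size s) F (nth c s i).
  rewrite -(big_mkord xpredT (fun i => F (nth c s i))) -(big_nth c xpredT F).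
  rewrite -big_enum /=; apply: perm_big.
  by rewrite perm_sym; apply/permPl/perm_sort.
have su : uniq s by rewrite sort_uniq enum_uniq.
have sN i : (i < size s)%N -> nearest S (nth c s i) = c.
  by move=> /(mem_nth c); rewrite mem_sort mem_enum inE => /eqP.
rewrite !sumE.
apply: (@le_trans _ _ (\sum_(i < size s) d c (nth c s i./2) ^+ z)); last first.
  apply: le_trans (sum_half_le _ (f := fun i => d c (nth c s i) ^+ z) _) _.
    by move=> i; exact: distX_ge0.
  rewrite ler_pM2l//; apply: ler_sum => i _.
  by rewrite sN// dist_sym.
apply: ler_sum => i _; rewrite estimateE sN// index_uniq//.
apply: lerXn2r; rewrite ?nnegrE ?dist_ge0//.
have h1 := @trunc_logP 2 i.+1 isT isT.
have h2 := @trunc_log_ltn 2 i.+1 isT.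
have := ltn_ord i => hi.
rewrite expnS in h2; set t := (2 ^ _)%N in h1 h2 *.
apply: farthest_first_mono; first by lia.
by rewrite -/s; lia.
Qed.

End Estimate.

(** * A single cluster and its kernel *)

Section Cluster.
Variables (O : {set 'I_n}) (o : 'I_n).

Definition spread : R := \sum_(y in O) d y o ^+ z.

(** The bound is twice the mean of [d y o ^+ z] over [O], with the division by [#|O|] cleared. *)
Definition kernel : {set 'I_n} :=
  [set x | #|O|%:R * d o x ^+ z <= 2 * spread].

Definition covered S : bool := ~~ [disjoint S & kernel].

Lemma spread_ge0 : 0 <= spread.
Proof. by apply: sumr_ge0 => y _; exact: distX_ge0. Qed.

(** Route every [y] through [o] to a center in the kernel: the second leg costs at most [2 * spread]
    in total. *)
Lemma covered_cost S : covered S -> cost_on S O <= 3 * 2 ^+ z * spread.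
Proof.
rewrite /covered -setI_eq0 => /set0Pn[x]; rewrite !inE => /andP[xS xk].
apply: (@le_trans _ _ (\sum_(y in O) 2 ^+ z * (d y o ^+ z + d o x ^+ z))).
  apply: ler_sum => y _.
  exact: le_trans (nearestX_le _ xS) (distX_triangle o _ _).
rewrite -mulr_sumr big_split /= sumr_const -/spread -mulr_natl.
rewrite -mulrA mulrCA ler_pM2l ?exprn_gt0//; lra.
Qed.

(* Markov's inequality for [d y o ^+ z] on [O]. *)
Lemma half_in_kernel : (#|O| <= 2 * #|O :&: kernel|)%N.
Proof.
have cO := cardsID kernel O.
rewrite leqNgt; apply/negP => lt.
have U0 : (0 < #|O :\: kernel|)%N by lia.
have : #|O :\: kernel|%:R * (2 * spread) < #|O|%:R * spread.
  apply: (@lt_le_trans _ _ (\sum_(y in O :\: kernel) #|O|%:R * d y o ^+ z)).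
    rewrite mulr_natl -sumr_const; apply: ltr_sum.
      case/card_gt0P: U0 => y yU.
      by apply/hasP; exists y; [exact: mem_index_enum|exact: yU].
    by move=> y; rewrite !inE -ltNge => /andP[+ _]; rewrite dist_sym.
  rewrite -mulr_sumr ler_wpM2l// /spread.
  rewrite [leRHS](big_setID kernel)/= lerDr.
  by apply: sumr_ge0 => y _; exact: distX_ge0.
apply/negP; rewrite -leNgt mulrA ler_wpM2r ?spread_ge0// -natrM ler_nat; lia.
Qed.

(** Cut the ranking of [o] at the last point of [O :&: kernel]: whatever is ranked before it is no
    farther from [o], hence in the kernel. *)
Lemma kernel_ball : O != finset.set0 ->
  exists p, rank_ball pi p \subset kernel /\ O :&: kernel \subset rank_ball pi p.
Proof.
move=> O0; have : (0 < #|O :&: kernel|)%N.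
  by have := half_in_kernel; move: O0; rewrite -card_gt0; lia.
case/card_gt0P => y0 y0K.
case: (arg_maxnP (P := mem (O :&: kernel)) (fun y => pi o y : nat) y0K).
move=> y yK ymax; exists (o, y); split; apply/fintype.subsetP => x.
  rewrite !inE /= => /rank_le_dist xy.
  have /setIP[_] : y \in O :&: kernel by [].
  rewrite inE; apply: le_trans.
  by rewrite ler_wpM2l//; apply: lerXn2r; rewrite ?nnegrE ?dist_ge0.
by move=> xK; rewrite inE /=; exact: ymax.
Qed.

(** Each [y] in [O] reaches [S] through [o], and [o] reaches [S] through any point of [K]. Averaging
    over [K] loses a factor 2, since [K] holds half of [O]; each detour loses [2 ^+ z]. *)
Lemma cost_on_le S (B : {set 'I_n}) : O != finset.set0 -> S != finset.set0 ->
  O :&: kernel \subset B ->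
  cost_on S O <= 2 ^+ (2 * z + 1) * (3 * spread + cost_on S B).
Proof.
move=> O0 S0 KB; set K := O :&: kernel in KB *.
set q := d o (nearest S o) ^+ z; have q0 : 0 <= q by exact: distX_ge0.
set N : R := #|O|%:R; have N0 : 0 < N by rewrite ltr0n card_gt0.
set e : R := 2 ^+ z; have e1 : 1 <= e by rewrite exprn_ege1// ler1n.
have up : cost_on S O <= e * (spread + N * q).
  apply: (@le_trans _ _ (\sum_(y in O) e * (d y o ^+ z + q))).
    apply: ler_sum => y _; apply: le_trans (distX_triangle o _ _).
    exact/nearestX_le/nearest_in.
  by rewrite -mulr_sumr big_split /= sumr_const -mulr_natl.
(* The extra factor [N] allows the kernel bound to be used without dividing; it is cancelled
   afterwards. *)
have low : N * (N * q) <= N * (2 * e * (2 * spread + cost_on S B)).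
  have h1 : #|K|%:R * (N * q) <= \sum_(y in K) e * (2 * spread + N * d y (nearest S y) ^+ z).
    rewrite mulr_natl -sumr_const; apply: ler_sum => y.
    rewrite !inE => /andP[_ yk].
    have h : q <= e * (d o y ^+ z + d y (nearest S y) ^+ z).
      apply: le_trans (distX_triangle y _ _).
      exact/nearestX_le/nearest_in.
    apply: (@le_trans _ _ (N * (e * (d o y ^+ z + d y (nearest S y) ^+ z)))).
      by rewrite ler_pM2l.
    by rewrite mulrCA ler_pM2l ?(lt_le_trans ltr01 e1)// mulrDr lerD2r.
  have h2 : \sum_(y in K) d y (nearest S y) ^+ z <= cost_on S B.
    rewrite /cost_on [leRHS](big_setID K)/= (finset.setIidPr KB) lerDl.
    by apply: sumr_ge0 => y _; exact: distX_ge0.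
  have h3 : N <= 2 * #|K|%:R by rewrite -natrM ler_nat half_in_kernel.
  have h4 : #|K|%:R <= N by rewrite ler_nat subset_leq_card// finset.subsetIl.
  rewrite -mulr_sumr big_split /= sumr_const -mulr_sumr -(mulr_natl (2 * spread)) in h1.
  apply: (@le_trans _ _ (2 * #|K|%:R * (N * q))).
    by rewrite ler_wpM2r// mulr_ge0// ltW.
  rewrite -mulrA (le_trans (ler_wpM2l _ h1))//.
  rewrite [leRHS](_ : _ = 2 * (e * (N * (2 * spread) + N * cost_on S B))); last by ring.
  rewrite ler_pM2l// ler_pM2l ?(lt_le_trans ltr01 e1)// lerD//.
    by rewrite ler_wpM2r// mulr_ge0// spread_ge0.
  by rewrite ler_pM2l.
rewrite ler_pM2l// in low.
have -> : 2 ^+ (2 * z + 1) = e * (2 * e) by rewrite exprD expr1 mulnC exprM /e; ring.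
apply: le_trans up _; rewrite -mulrA ler_pM2l ?(lt_le_trans ltr01 e1)//.
(* Beyond [low], this needs only [D <= 2 * e * D], from [1 <= e]. *)
have := spread_ge0; set D := spread in low *; set w := cost_on _ _ in low *.
by nra.
Qed.

End Cluster.

(** * Effect of the rounds *)

Local Notation next := (next_centers z k pi d).

Lemma next_sup S : S \subset next S.
Proof. exact: finset.subsetUl. Qed.

Lemma iter_next_neq0 t S : S != finset.set0 -> iter t next S != finset.set0.
Proof.
move=> S0; elim: t => //= t; apply: contra => /eqP h.
by have := next_sup (iter t next S); rewrite h finset.subset0.
Qed.

(** There are at most [n * n] balls, fewer than [2 ^ (2 * bits n)], so [hitting_set] makes the
    search in [enlarge] succeed. *)
Lemma next_hits_heavy S p : (0 < k)%N -> S != finset.set0 ->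
  heavy_ball z k pi S (known d (probes pi S)) p ->
  ~~ [disjoint next S & rank_ball pi p].
Proof.
move=> k0 S0 hp; rewrite /next_centers /enlarge; set e := known d _ in hp *.
have [H hH] : exists H, hits_heavy z k pi S e H.
  have [] := @hitting_set R _ _ (rank_ball pi) (estimate z pi S e) (thinness z k)
    [set p | heavy_ball z k pi S e p] _ _ _ (2 * bits n).
  - exact: estimate_ge0.
  - by case/andP: hp.
  - by move=> j; rewrite inE => /andP[].
  - by rewrite /thinness addnC expnD; have := expn_gt0 2 (2 * z); nia.
  - apply: (@leq_ltn_trans (n * n)).
      by rewrite (leq_trans (max_card _))// card_prod card_ord.
    by rewrite mulnC expnM -mulnn; apply: ltn_mul; exact: trunc_log_ltn.
  move=> H [cH hH]; exists H; rewrite /hits_heavy cH /=.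
  by apply/forallP => q; apply/implyP => hq; apply: hH; rewrite inE.
case: pickP => [H' /andP[_ /forallP/(_ p)]|/(_ H)]; last by rewrite hH.
rewrite hp /=; apply: contra; apply: disjointWl.
exact: finset.subsetUr.
Qed.

Section Progress.
Variable C : {set 'I_n}.
Hypotheses (k_gt0 : (0 < k)%N) (card_C : #|C| = k).

Let C_neq0 : C != finset.set0. Proof. by rewrite -card_gt0 card_C. Qed.

Local Notation covered_center S o := (covered (cell C o) o S).
Let E : R := 2 ^+ (2 * z + 1).

Lemma sum_spread : \sum_(o in C) spread (cell C o) o = cost C.
Proof.
rewrite /cost (sum_cell _ C_neq0); apply: eq_bigr => o _.
by apply: eq_bigr => y; rewrite inE => /eqP ->.
Qed.

Lemma cell_neq0 o : o \in C -> cell C o != finset.set0.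
Proof.
move=> oC; apply/set0Pn; exists o; rewrite inE; apply/eqP/esym/dist_eq0.
by apply/le_anti; rewrite dist_ge0 andbT -(dist_xx o) nearest_le.
Qed.

Lemma next_covers S : S != finset.set0 -> 6 * E * cost C < cost S ->
  exists2 o, o \in C & ~~ covered_center S o && covered_center (next S) o.
Proof.
move=> S0 hS.
have E1 : 1 <= E by rewrite exprn_ege1// ler1n.
have C0 := cost_ge0 C.
have EC0 : 0 <= E * cost C by rewrite mulr_ge0// (le_trans ler01 E1).
(* The excess of a cluster over [3 * E * spread] sums to more than [cost S / 2], so some cluster has
   a [1/k] share of that half. *)
have [] := @exists_sum_ge R _ (mem C)
    (fun o => cost_on S (cell C o) - 3 * E * spread (cell C o) o) k (cost S / 2).
- exact: card_C.
- by lra.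
- by rewrite sumrB -mulr_sumr sum_spread -(sum_cell _ C_neq0) -/(cost S); lra.
move=> o oC ho; exists o => //.
have D0 := spread_ge0 (cell C o) o.
set D := spread _ _ in ho D0; set w := cost_on _ _ in ho.
have wD : 0 < w - 3 * E * D.
  by rewrite -(pmulr_rgt0 _ (_ : 0 < k%:R)) ?ltr0n//; lra.
apply/andP; split.
  (* A covered cluster has no positive excess. *)
  apply/negP => /covered_cost; rewrite -/D -/w => hw.
  have : 3 * 2 ^+ z * D <= 3 * E * D.
    rewrite ler_wpM2r// ler_pM2l// ler_eXn2l ?ltr1n//; lia.
  lra.
have [p [pK Kp]] := kernel_ball o (cell_neq0 oC).
have hw := cost_on_le (cell_neq0 oC) S0 Kp.
rewrite -/w -/D -/E in hw.
(* The excess is at most [E] times the cost of the ball, so the ball is heavy; hitting it means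
   hitting the kernel. *)
have hp : heavy_ball z k pi S (known d (probes pi S)) p.
  have cB : cost_on S (rank_ball pi p) <=
      \sum_(y in rank_ball pi p) estimate z pi S (known d (probes pi S)) y.
    by apply: ler_sum => y _; exact: estimate_ge.
  have cS : cost S <= \sum_y estimate z pi S (known d (probes pi S)) y.
    by apply: ler_sum => y _; exact: estimate_ge.
  rewrite /heavy_ball; apply/andP; split; first by lra.
  apply: le_trans (sum_estimate_le S0) _.
  have -> : (thinness z k)%:R = k%:R * (4 * E) :> R.
    rewrite /thinness natrM natrX /E !exprD; congr (_ * _).
    by rewrite expr1 -[3%N]/(1 + 2)%N exprD; ring.
  apply: (@le_trans _ _ (k%:R * (4 * E) * cost_on S (rank_ball pi p))); last first.
    by rewrite ler_wpM2l// mulr_ge0//; lra.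
  have : k%:R * (w - 3 * E * D) <= k%:R * (E * cost_on S (rank_ball pi p)).
    by rewrite ler_wpM2l//; lra.
  lra.
apply: contra (next_hits_heavy k_gt0 S0 hp); apply: disjointWr.
exact: pK.
Qed.

Lemma covered_next S o : covered_center S o -> covered_center (next S) o.
Proof. by apply: contra; apply: disjointWl; exact: next_sup. Qed.

(** Adding centers preserves both alternatives, and a round started at high cost covers one more
    cluster. *)
Lemma progress t S : S != finset.set0 ->
  cost (iter t next S) <= 6 * E * cost C \/
  (t <= #|[set o in C | covered_center (iter t next S) o]|)%N.
Proof.
move=> S0; elim: t => [|t [IHt|IHt]]; first by right.
  left; apply: le_trans IHt; apply: cost_mono; last exact: next_sup.
  exact: iter_next_neq0.
case: (leP (cost (iter t next S)) (6 * E * cost C)) => h.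
  left; apply: le_trans h; apply: cost_mono; last exact: next_sup.
  exact: iter_next_neq0.
right; have [c cC /andP[c1 c2]] := next_covers (iter_next_neq0 t S0) h.
apply: leq_ltn_trans IHt _; apply: proper_card; apply/properP; split.
  apply/fintype.subsetP => x; rewrite !inE => /andP[-> /=]; exact: covered_next.
by exists c; rewrite !inE cC //= (negbTE c1).
Qed.

(** If the cost is not yet small, all [k] clusters are covered and [covered_cost] is summed over
    them. *)
Lemma cost_rounds S : S != finset.set0 ->
  cost (iter k next S) <= 6 * E * cost C.
Proof.
move=> S0; case: (progress k S0) => //; set S' := iter k next S => hk.
have all_cov o : o \in C -> covered_center S' o.
  have eqC : [set o in C | covered_center S' o] = C.
    apply/eqP; rewrite eqEcard card_C hk andbT; apply/fintype.subsetP => x.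
    by rewrite inE => /andP[].
  by rewrite -{1}eqC inE => /andP[].
rewrite /cost (sum_cell _ C_neq0) -/(cost C) -sum_spread mulr_sumr.
apply: ler_sum => o oC; apply: le_trans (covered_cost (all_cov o oC)) _.
rewrite ler_wpM2r ?spread_ge0//.
have E0 : 0 <= E by exact: exprn_ge0.
apply: (@le_trans _ _ (3 * E)); last by lra.
by rewrite ler_pM2l// ler_eXn2l ?ltr1n//; lia.
Qed.

(** * Choice of the final centers *)

Lemma exists_best S (e : 'I_n -> 'I_n -> R) : S != finset.set0 ->
  admissible k S (best_subset z k pi S e) /\
  forall T, admissible k S T ->
    proxy_cost z pi S e (best_subset z k pi S e) <= proxy_cost z pi S e T.
Proof.
case/set0Pn => s sS.
have s1 : admissible k S [set s].
  by rewrite /admissible finset.sub1set sS -card_gt0 cards1.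
rewrite /best_subset; case: pickP => [T /andP[aT /forallP hT]|no] /=.
  by split => // T' aT'; exact: (implyP (hT T')).
have := @arg_minP _ _ _ [set s] (admissible k S) (proxy_cost z pi S e) s1.
case=> T aT hT; have /negP[] := negbT (no T); rewrite aT /=.
by apply/forallP => T'; apply/implyP; exact: hT.
Qed.

(** Compare with the centers of [C] moved to their nearest points of [S]. Such a move at most
    doubles the distance from a point of [S], because that point is itself a candidate. *)
Lemma cost_best S : S != finset.set0 ->
  cost (best_subset z k pi S (known d [seq (a, b) | a <- enum S, b <- enum S]))
  <= 2 ^+ z * (cost S + 4 ^+ z * (cost S + cost C)).
Proof.
move=> S0; set e := known d _; set T := best_subset _ _ _ _ _.
have [aT hT] := exists_best e S0; rewrite -/T in aT hT.
(* Only distances inside [S] enter, all of them queried. *)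
have proxyE T' : admissible k S T' ->
    proxy_cost z pi S e T' = \sum_y d (nearest S y) (nearest T' (nearest S y)) ^+ z.
  case/and3P => T'S T'0 _; apply: eq_bigr => y _; rewrite -distC_nearest//.
  have eE c : c \in T' -> e (nearest S y) c = d (nearest S y) c.
    move=> cT; rewrite /e /known ifT//; apply/allpairsP; exists (nearest S y, c).
    by rewrite !mem_enum nearest_in// (fintype.subsetP T'S).
  congr (_ ^+ _); rewrite /distC; case: pickP => [c cT|no] /=.
    by rewrite eE//; apply: eq_bigr.
  by case/set0Pn: T'0 => c; rewrite no.
have z0 : 0 < 2 ^+ z :> R by rewrite exprn_gt0.
apply: (@le_trans _ _ (\sum_y 2 ^+ z * (d y (nearest S y) ^+ z
    + d (nearest S y) (nearest T (nearest S y)) ^+ z))).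
  apply: ler_sum => y _; apply: le_trans (distX_triangle _ _ _).
  by apply/nearestX_le/nearest_in; case/and3P: aT.
rewrite -mulr_sumr ler_pM2l// big_split /= lerD2l -proxyE//.
pose T' := [set nearest S o | o in C].
have aT' : admissible k S T'.
  apply/and3P; split.
  - by apply/fintype.subsetP => x /imsetP[c _ ->]; exact: nearest_in.
  - case/set0Pn: C_neq0 => o oC; apply/set0Pn; exists (nearest S o).
    exact: imset_f.
  - by rewrite -card_C leq_imset_card.
apply: le_trans (hT _ aT') _; rewrite proxyE// -big_split /= mulr_sumr.
apply: ler_sum => y _; set s := nearest S y; set o := nearest C y.
have oT : nearest S o \in T' by apply: imset_f; exact: nearest_in.
apply: le_trans (nearestX_le _ oT) _.
have h : d s (nearest S o) <= 2 * (d s y + d y o).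
  have h1 := dist_triangle o s (nearest S o).
  have h2 : d o (nearest S o) <= d o s by apply: nearest_le; exact: nearest_in.
  have h3 := dist_triangle y s o.
  by rewrite (dist_sym o s) in h2; lra.
have -> : 4 ^+ z = 2 ^+ z * 2 ^+ z :> R by rewrite -exprMn; congr (_ ^+ _); lra.
apply: le_trans (_ : (2 * (d s y + d y o)) ^+ z <= _).
  by apply: lerXn2r; rewrite ?nnegrE ?mulr_ge0 ?addr_ge0 ?dist_ge0.
rewrite exprMn -mulrA ler_pM2l// (dist_sym y s).
by apply: exprD_le2X; exact: dist_ge0.
Qed.

End Progress.
End Analysis.

(** * Optimum, roots and logarithms; the theorem *)

Lemma OPT_attained (R : realType) (z k n : nat) (d : 'I_n -> 'I_n -> R) :
  (k <= n)%N -> exists C : {set 'I_n}, #|C| = k /\ phi z d C = OPT z k d.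
Proof.
move=> kn; apply: (big_ind (fun v => exists C : {set 'I_n}, #|C| = k /\ phi z d C = v)).
- exists [set i : 'I_n | (i < k)%N]; split => //.
  rewrite -sum1dep_card (big_ord_narrow kn) /= sum1_card card_ord //.
- by move=> a b hA hB; rewrite /Num.min; case: ifP.
- by move=> C /eqP cC; exists C.
Qed.

(** The constant leaves the root as [c ^ (1/z)], at most [c] because [1 <= c]. *)
Lemma powR_root_le (R : realType) (z c : nat) (a b : R) : (0 < z)%N -> (0 < c)%N ->
  0 <= a -> 0 <= b -> a <= c%:R * b -> powR a z%:R^-1 <= c%:R * powR b z%:R^-1.
Proof.
move=> z0 c0 a0 b0 ab.
have zi : 0 <= z%:R^-1 :> R by rewrite invr_ge0.
apply: le_trans (_ : powR (c%:R * b) z%:R^-1 <= _).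
  by apply: ge0_ler_powR => //; rewrite nnegrE// mulr_ge0.
rewrite powRM// ler_wpM2r ?powR_ge0//.
rewrite -[leRHS]powRr1//; apply: ler_powR; first by rewrite ler1n.
by rewrite invf_le1 ?ltr0n// ler1n.
Qed.

(** For [n >= 2] the truncated logarithm is at least 1, so adding 1 at most doubles it. *)
Lemma bits_le_ln (R : realType) (n : nat) : (1 < n)%N ->
  (bits n)%:R <= 2 / ln 2 * ln (n%:R : R).
Proof.
move=> n1; have l2 : 0 < ln 2 :> R by rewrite ln_gt0// ltr1n.
have tl : (0 < trunc_log 2 n)%N by rewrite trunc_log_gt0.
have h : (trunc_log 2 n)%:R * ln 2 <= ln (n%:R : R).
  rewrite mulr_natl -lnXn// ler_ln ?posrE ?exprn_gt0 ?ltr0n 1?ltnW//.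
  by rewrite -natrX ler_nat trunc_logP// ltnW.
rewrite mulrAC ler_pdivlMr//.
apply: le_trans (_ : 2 * ((trunc_log 2 n)%:R * ln 2) <= _); last by rewrite ler_pM2l.
by rewrite mulrA ler_pM2r// -natrM ler_nat /bits; lia.
Qed.

Unset Implicit Arguments.

Theorem mainTheorem7 (R : realType) (z : nat) (hz : (0 < z)%N) :
  exists (cq ca : R), 0 < cq /\ 0 < ca /\
  forall k : nat, (0 < k)%N ->
  exists A : algorithm R,
  forall (n : nat) (d : 'I_n -> 'I_n -> R) (pi : profile n),
    (k <= n)%N -> is_metric d -> consistent d pi ->
    [/\ (num_queries d (A n pi))%:R
          <= cq * (k%:R) ^+ 4 * (ln (n%:R : R)) ^+ 5,
        all_outputs d (fun C => C != finset.set0 /\ (#|C| <= k)%N) (A n pi)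
      & expect d (phi z d) (A n pi) <= ca * OPT z k d].
Proof.
pose E := (2 ^ (2 * z + 1))%N.
(* The bound of [cost_best] with [6 * E * cost C] in place of [cost S]. *)
pose c := (2 ^ z * (6 * E + 4 ^ z * (6 * E + 1)))%N.
have l2 : 0 < ln 2 :> R by rewrite ln_gt0// ltr1n.
have c_gt0 : (0 < c)%N by rewrite !(muln_gt0, addn_gt0, expn_gt0).
have q_gt0 : 0 < 2 ^+ (4 * z + 12) * (2 / ln 2) ^+ 5 :> R.
  by rewrite mulr_gt0// exprn_gt0// divr_gt0.
exists (2 ^+ (4 * z + 12) * (2 / ln 2) ^+ 5), c%:R.
split => //; split; first by rewrite ltr0n.
move=> k k0; exists (fun n pi => kclustering R z k pi) => n d pi kn dm dpi.
have n0 : (0 < n)%N by exact: leq_trans kn.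
have ln0 : 0 <= ln (n%:R : R) by rewrite ln_ge0// ler1n.
have n_card (C : {set 'I_n}) : (0 < #|C|)%N -> C != finset.set0 by rewrite card_gt0.
have [C [cC <-]] := OPT_attained z d kn.
have C0 : C != finset.set0 by rewrite -card_gt0 cC.
have cstC : 0 <= cost z d pi C by exact: cost_ge0.
case: (leqP n k) => nk.
  rewrite /kclustering nk /=; split.
  - apply: mulr_ge0; last exact: exprn_ge0.
    by apply: mulr_ge0; [exact: ltW | exact: exprn_ge0].
  - by rewrite cardsT card_ord; split => //; apply: n_card; rewrite cardsT card_ord.
  have T0 : finset.setTfor 'I_n != finset.set0.
    by apply: n_card; rewrite cardsT card_ord.
  rewrite (phi_cost _ dpi T0) (phi_cost _ dpi C0); apply: powR_root_le => //.
    exact: cost_ge0.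
  rewrite [leLHS]big1 ?mulr_ge0// => y _.
  suff -> : d y (nearest_center pi [set: 'I_n] y) = 0 by rewrite expr0n; case: (z) hz.
  apply/le_anti; rewrite dist_ge0// andbT -(dist_xx dm y).
  by apply: nearest_le; rewrite ?inE.
have S0 : [set x : 'I_n | x == 0 :> nat]%N != finset.set0.
  by apply/set0Pn; exists (Ordinal n0); rewrite inE.
split.
- have n1 : (1 < n)%N by lia.
  apply: (@le_trans _ _ (2 ^ (4 * z + 12) * k ^ 4 * bits n ^ 5)%:R).
    by rewrite ler_nat num_queries_kclustering.
  rewrite natrM [X in X * _ <= _]natrM !natrX [leRHS](_ : _ = 2 ^+ (4 * z + 12) * k%:R ^+ 4
    * (2 / ln 2 * ln n%:R) ^+ 5); last first.
    by rewrite (exprMn 5 (2 / ln 2)) -[LHS]mulrA -[LHS]mulrA -[RHS]mulrA [X in _ = _ * X]mulrCA.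
  rewrite ler_wpM2l//.
  apply: lerXn2r; rewrite ?nnegrE ?bits_le_ln//.
  by apply: mulr_ge0 => //; apply: divr_ge0 => //; exact: ltW.
- rewrite /kclustering leqNgt nk /= all_outputs_rounds all_outputs_ask /=.
  have [/and3P[_ -> ->]] := exists_best z pi k0 (known d [seq (a, b)
     | a <- enum (iter k (next_centers z k pi d) [set x : 'I_n | x == 0 :> nat]%N),
       b <- enum (iter k (next_centers z k pi d) [set x : 'I_n | x == 0 :> nat]%N)])
     (iter_next_neq0 z k d pi k S0).
  by [].
rewrite /kclustering leqNgt nk /= expect_rounds expect_ask /=.
set S := iter _ _ _; set T := best_subset _ _ _ _ _.
have S'0 : S != finset.set0 by exact: iter_next_neq0.
have T0 : T != finset.set0.
  by have [/and3P[]] := exists_best z pi k0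
       (known d [seq (a, b) | a <- enum S, b <- enum S]) S'0.
rewrite (phi_cost _ dpi T0) (phi_cost _ dpi C0); apply: powR_root_le => //.
  exact: cost_ge0.
apply: le_trans (cost_best z dm dpi k0 cC S'0) _.
have h := cost_rounds z dm dpi k0 cC S0; rewrite -/S in h.
have e2 : 0 <= 2 ^+ z :> R by exact: exprn_ge0.
have e4 : 0 <= 4 ^+ z :> R by exact: exprn_ge0.
rewrite /c natrM natrD !natrM natrD !natrX natrM natrX -mulrA ler_wpM2l//.
rewrite mulrDl -mulrA lerD// ?mulrA// -mulrA ler_wpM2l// mulrDl mul1r lerD2r.
exact: h.
Qed.
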